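(* There exists a function $f:(0,\infty)\to\mathbb{R}$ such that for every $\epsilon>0$, every finite simple graph $G$ with $\mathrm{mad}(G)<3-\epsilon$ and $\Delta(G)\ge f(\epsilon)$ satisfies $\chi^2_\ell(G)=\Delta(G)+1$.
   Context: $\Delta(G)$ is the maximum degree of $G$. The average degree of a graph $H$ is $2|E(H)|/|V(H)|$, and the maximum average degree $\mathrm{mad}(G)$ is the maximum of the average degree over all subgraphs $H$ of $G$. The square of $G$ is the graph on $V(G)$ in which two distinct vertices are adjacent iff they are adjacent in $G$ or have a common neighbor in $G$. $\chi^2_\ell(G)$ is the smallest integer $k$ such that for every assignment of a list of $k$ colors to each vertex, there is a proper coloring of the square of $G$ in which each vertex receives a color from its list. *)

(* Defs.v *)
From mathcomp Require Import all_boot.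
From Stdlib Require Import Reals.
Set Implicit Arguments. Unset Strict Implicit. Unset Printing Implicit Defensive.

(* A finite simple graph: vertex type T : finType, adjacency e : rel T,
   assumed symmetric and irreflexive in the theorem. *)

Definition deg (T : finType) (e : rel T) (x : T) : nat := #|[set y | e x y]|.

(* maximum degree Delta(G) (0 for the empty graph) *)
Definition maxdeg (T : finType) (e : rel T) : nat := \max_(x : T) deg e x.

(* number of edges of the induced subgraph G[S]: ordered adjacent pairs / 2 *)
Definition nedges (T : finType) (e : rel T) (S : {set T}) : nat :=
  #|[set p : T * T | [&& p.1 \in S, p.2 \in S & e p.1 p.2]]| ./2.

Definition avgdeg (T : finType) (e : rel T) (S : {set T}) : R :=
  (2 * INR (nedges e S) / INR #|S|)%R.

(* maximum average degree: maximum over (nonempty) induced subgraphs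
   (equal to the maximum over all subgraphs, since deleting edges never
   increases the average degree); 0 for the empty graph *)
Definition mad (T : finType) (e : rel T) : R :=
  \big[Rmax/0%R]_(S : {set T} | S != set0) avgdeg e S.

Definition sqrel (T : finType) (e : rel T) : rel T :=
  fun x y => (x != y) && (e x y || [exists z, e x z && e z y]).

Definition sq_choosable (T : finType) (e : rel T) (k : nat) : Prop :=
  forall L : T -> seq nat,
    (forall v, uniq (L v) /\ size (L v) = k) ->
    exists c : T -> nat,
      (forall v, c v \in L v) /\
      (forall x y, sqrel e x y -> c x != c y).

Definition is_chi2l (T : finType) (e : rel T) (k : nat) : Prop :=
  sq_choosable e k /\ (forall j, (j < k)%N -> ~ sq_choosable e j).

(* Main.v *)
Require Import Defs.
From mathcomp Require Import all_boot zify.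
From Stdlib Require Import Reals Lra.
Set Implicit Arguments. Unset Strict Implicit. Unset Printing Implicit Defensive.

(** Induction on the number of edges, with [k] at least the maximum degree and
    lists of size [k + 1]. Fix [n >= 1/eps] and call a vertex big if its degree is
    at least [M = 3 n + n^2]. By discharging at [3 - 1/n], each big vertex sends
    [1 - 1/n] along every edge and keeps a surplus of [n] per big vertex. The only
    vertices left in need are the threads: the vertices of degree 2 without big
    neighbour. A thread with a neighbour that has no big neighbour is reducible,
    and a neighbour with two big neighbours pays for the thread; the other threads
    join small vertices with exactly one big neighbour (their hub) into clusters.
    A cluster lacks charge, and then at most [1], only if it is tight: it has at
    most [n] vertices and no edges other than those to the hubs and to its threads.
    If there are more than [n] tight clusters per big vertex, Hall's theorem finds
    tight clusters on a set of hubs such that every hub is the root of [n] of them.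
    Uncolour these clusters. A vertex then has as many free colours as its hub has
    uncoloured neighbours, and recolouring amounts to list edge colouring the
    bipartite multigraph between hubs and clusters, which Galvin's kernel method
    achieves with each root first in its cluster and last at its hub. *)

(** * List edge colouring of bipartite multigraphs *)

(** Galvin's orientation of the line graph: smaller rank is preferred, at either end. *)
Definition beats (E A B : eqType) (a : E -> A) (b : E -> B) (ra rb : E -> nat) :
    rel E :=
  fun x y => ((a x == a y) && (ra x < ra y)) || ((b x == b y) && (rb x < rb y)).

(* Either the favourites of the [A]-side form a matching, or two of them collide
   on the [B]-side; the loser of a collision can be deleted, because whatever
   beats the winner there also beats the loser. *)
Lemma stable_kernel (E : finType) (A B : eqType) (a : E -> A) (b : E -> B)
    (ra rb : E -> nat) (X : {set E}) :
  injective ra -> injective rb ->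
  exists K : {set E}, [/\ K \subset X,
    {in K &, forall x y, x != y -> a x != a y /\ b x != b y}
    & {in X :\: K, forall y, exists2 x, x \in K & beats a b ra rb x y}].
Proof.
move=> ia ib; have [m] := ubnP #|X|; elim: m X => // m IHm X leXm.
pose F := [set x in X | [forall y in X, (a y == a x) ==> (ra x <= ra y)]].
have FP x : x \in F -> x \in X /\ (forall y, y \in X -> a y = a x -> ra x <= ra y).
  rewrite inE => /andP[xX /forall_inP H]; split=> // y yX /eqP axy.
  by have /implyP := H y yX; apply.
have [/existsP[x /existsP[y /and5P[xF yF nxy /eqP bxy ltxy]]]|noc] :=
    boolP [exists x, exists y, [&& x \in F, y \in F, x != y, b x == b y & rb x < rb y]].
  have [xX fx] := FP x xF; have [yX fy] := FP y yF.
  have [|K [KX indK domK]] := IHm (X :\ y).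
    by move: leXm; rewrite (cardsD1 y X) yX.
  exists K; split=> //.
    by apply: subset_trans KX _; apply: subD1set.
  move=> z; rewrite inE => /andP[zK zX].
  have [->|nzy] := eqVneq z y; last by apply: domK; rewrite !inE zK nzy.
  have [xK|xK] := boolP (x \in K).
    by exists x => //; rewrite /beats bxy eqxx ltxy orbT.
  have [|t tK /orP[/andP[/eqP atx ltx]|/andP[/eqP btx ltx]]] := domK x.
  - by rewrite !inE xK nxy.
  - have tX : t \in X by move/subsetP: KX => /(_ _ tK); rewrite !inE => /andP[].
    by have := fx t tX atx; rewrite leqNgt ltx.
  - by exists t => //; rewrite /beats btx bxy eqxx (ltn_trans ltx ltxy) orbT.
exists F; split.
- by apply/subsetP=> x /FP[].
- move=> x y xF yF nxy; have [xX fx] := FP x xF; have [yX fy] := FP y yF; split.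
    apply: contra nxy => /eqP axy; apply/eqP/ia.
    by apply/eqP; rewrite eqn_leq fx // fy.
  apply: contraNN noc => /eqP bxy.
  have [ltr|ltr|/ib eqr] := ltngtP (rb x) (rb y); last by rewrite eqr eqxx in nxy.
  - by apply/existsP; exists x; apply/existsP; exists y; rewrite xF yF nxy bxy eqxx ltr.
  - by apply/existsP; exists y; apply/existsP; exists x;
      rewrite xF yF eq_sym nxy bxy eqxx ltr.
move=> y; rewrite inE => /andP[yF yX].
have Py : (y \in X) && (a y == a y) by rewrite yX eqxx.
case: (@arg_minnP _ y (fun x => (x \in X) && (a x == a y)) ra Py) => x /andP[xX /eqP axy] minx.
have xF : x \in F.
  rewrite inE xX; apply/forall_inP=> z zX; apply/implyP=> /eqP azx.
  by apply: minx; rewrite zX azx axy eqxx.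
exists x => //; rewrite /beats axy eqxx /= ltn_neqAle minx ?Py // andbT.
suff -> : ra x != ra y by [].
by apply: contraNneq yF => /ia <-.
Qed.

Lemma uniq_filter_size (s : seq nat) (c : nat) :
  uniq s -> size s <= (size [seq d <- s | d != c]) + (c \in s).
Proof.
move=> us; rewrite -(count_predC (pred1 c) s) addnC size_filter.
by rewrite leq_add2l count_uniq_mem.
Qed.

(* Galvin's kernel method for edge colouring the bipartite multigraph whose
   edges are the elements of [X], [x] joining [a x] to [b x]. *)
Lemma galvin (E : finType) (A B : eqType) (a : E -> A) (b : E -> B)
    (ra rb : E -> nat) (X : {set E}) (L : E -> seq nat) :
  injective ra -> injective rb ->
  {in X, forall x, uniq (L x) /\
     #|[set y in X | beats a b ra rb y x]| < size (L x)} ->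
  exists c : E -> nat, {in X, forall x, c x \in L x} /\
    {in X &, forall x y, x != y -> (a x == a y) || (b x == b y) -> c x != c y}.
Proof.
move=> ia ib; have [m] := ubnP #|X|; elim: m X L => // m IHm X L leXm HL.
have [->|[x0 x0X]] := set_0Vmem X.
  by exists (fun=> 0); split=> x; rewrite inE.
have [_ L0] := HL x0 x0X.
have [c0 c0L] : exists c0, c0 \in L x0.
  by case: (L x0) L0 => // c0 s _; exists c0; rewrite mem_head.
(* The kernel among the edges that allow [c0] receives [c0]; all other edges drop [c0] from their
   lists. *)
have [K [KA indK domK]] := stable_kernel a b [set x in X | c0 \in L x] ia ib.
have KX : K \subset X by apply: subset_trans KA _; apply/subsetP=> x; rewrite inE => /andP[].
have [x1 x1K] : exists x1, x1 \in K.
  have [x0K|x0K] := boolP (x0 \in K); first by exists x0.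
  by have [|x1 x1K _] := domK x0; [rewrite !inE x0K x0X | exists x1].
have [||c [cL cP]] := IHm (X :\: K) (fun x => [seq d <- L x | d != c0]).
- apply: leq_trans (proper_card _) leXm; apply/properP; split.
    by apply: subsetDl.
  by exists x1; [apply: (subsetP KX) | rewrite inE x1K].
- move=> x; rewrite inE => /andP[xK xX]; have [uL sL] := HL x xX.
  split; first exact: filter_uniq.
  have [c0x|c0x] := boolP (c0 \in L x); last first.
    have -> : [seq d <- L x | d != c0] = L x.
      by apply/all_filterP/allP=> d dL; apply: contraNneq c0x => <-.
    apply: leq_ltn_trans sL; apply: subset_leq_card; apply/subsetP=> y.
    by rewrite !inE => /andP[/andP[_ ->] ->].
  (* An edge that loses [c0] also loses a rival, the kernel edge [t] that beats it. *)
  have [|t tK bt] := domK x; first by rewrite !inE xK xX.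
  have := uniq_filter_size c0 uL; rewrite c0x addn1 => sz.
  have : #|[set y in X :\: K | beats a b ra rb y x]| < #|[set y in X | beats a b ra rb y x]|.
    apply: proper_card; apply/properP; split.
      by apply/subsetP=> y; rewrite !inE => /andP[/andP[_ ->] ->].
    by exists t; rewrite !inE ?tK // (subsetP KX) // bt.
  by move=> lt1; apply: leq_trans lt1 _; rewrite -ltnS; apply: leq_trans sL sz.
exists (fun x => if x \in K then c0 else c x); split=> [x xX|x y xX yX nxy ab].
  case: ifPn => xK.
    by move/subsetP: KA => /(_ x xK); rewrite inE => /andP[].
  by have := cL x; rewrite inE xK xX mem_filter => /(_ isT) /andP[].
have cK z : z \in X -> z \notin K -> c z != c0.
  by move=> zX zK; have := cL z; rewrite inE zK zX mem_filter => /(_ isT) /andP[].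
case: ifPn => xK; case: ifPn => yK.
- by have [/negPf na /negPf nb] := indK x y xK yK nxy; rewrite na nb in ab.
- by rewrite eq_sym cK.
- by rewrite cK.
- by apply: cP => //; rewrite inE ?xK ?yK.
Qed.

(* Roots come first in their [b]-class and last in their [a]-class; the [n] roots
   of an [a]-class leave enough room for the [n - 1] rivals that a non-root may
   have in its [b]-class. *)
Lemma galvin_rooted (E : finType) (A B : eqType) (a : E -> A) (b : E -> B)
    (n : nat) (rt : pred E) (X : {set E}) (L : E -> seq nat) :
  {in X &, forall x y, rt x -> rt y -> b x = b y -> x = y} ->
  {in X, forall x, #|[set y in X | b y == b x]| <= n} ->
  {in X, forall x, n <= #|[set y in X | (a y == a x) && rt y]|} ->
  {in X, forall x, uniq (L x) /\ #|[set y in X | a y == a x]| <= size (L x)} ->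
  exists c : E -> nat, {in X, forall x, c x \in L x} /\
    {in X &, forall x y, x != y -> (a x == a y) || (b x == b y) -> c x != c y}.
Proof.
move=> rt1 bn an HL.
(* The shift by [#|E|] puts roots last in [ra] and first in [rb]; [enum_rank] breaks ties. *)
pose ra y := enum_rank y + rt y * #|E|; pose rb y := enum_rank y + ~~ rt y * #|E|.
have ltr (x : E) : enum_rank x < #|E| by apply: ltn_ord.
have ia : injective ra.
  move=> x y; rewrite /ra => eqr; apply/enum_rank_inj/val_inj => /=.
  by move: eqr (ltr x) (ltr y); case: (rt x); case: (rt y) => /=; lia.
have ib : injective rb.
  move=> x y; rewrite /rb => eqr; apply/enum_rank_inj/val_inj => /=.
  by move: eqr (ltr x) (ltr y); case: (rt x); case: (rt y) => /=; lia.
apply: (galvin ia ib) => x xX; have [uL sL] := HL x xX; split=> //.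
apply: leq_trans sL; have [rtx|nrtx] := boolP (rt x).
  apply: proper_card; apply/properP; split; last first.
    by exists x; rewrite !inE xX ?eqxx //= /beats !ltnn !andbF.
  apply/subsetP=> y; rewrite !inE => /andP[yX]; rewrite yX /= => /orP[/andP[] //|].
  rewrite /rb rtx /= => /andP[/eqP bxy lty].
  have rty : rt y by move: lty (ltr x); case: (rt y) => //=; lia.
  by move: lty; rewrite (rt1 y x yX xX rty rtx bxy) rtx ltnn.
have sub : [set y in X | beats a b ra rb y x] \subset
   ([set y in X | (a y == a x) && ~~ rt y] :\ x) :|: ([set y in X | b y == b x] :\ x).
  apply/subsetP=> y; rewrite !inE => /andP[-> /=].
  have [->|_] := eqVneq y x; first by rewrite /beats !ltnn !andbF.
  rewrite /= => /orP[/andP[-> lty]|/andP[-> _]]; last by rewrite orbT.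
  by move: lty (ltr x); rewrite /ra (negPf nrtx); case: (rt y) => //=; lia.
have := leq_trans (subset_leq_card sub) (leq_card_setU _ _).
have := bn x xX; have := an x xX.
rewrite (cardsD1 x [set y in X | b y == b x]) !inE xX eqxx /=.
rewrite -(cardsID [set y | rt y] [set y in X | a y == a x]).
have -> : [set y in X | a y == a x] :&: [set y | rt y] = [set y in X | (a y == a x) && rt y].
  by apply/setP=> y; rewrite !inE andbA.
have -> : [set y in X | a y == a x] :\: [set y | rt y] = [set y in X | (a y == a x) && ~~ rt y].
  by apply/setP=> y; rewrite !inE andbC andbA.
rewrite (cardsD1 x [set y in X | (a y == a x) && ~~ rt y]) !inE xX eqxx nrtx /=.
lia.
Qed.

(** * Hall's theorem with multiplicities *)

(* Rado's shrinking proof of Hall's theorem: in a minimal family of subsets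
   satisfying the condition every member has at most one element, since otherwise
   two tight sets violate submodularity of the number of members hit. *)
Lemma hall_multi (T I : finType) (n : nat) (J : {set I}) (W : {set T})
    (inc : I -> {set T}) :
  (forall S : {set T}, S \subset W ->
     n * #|S| <= \sum_(j in J) (inc j :&: S != set0)) ->
  exists rho : I -> {set T}, [/\ forall i, rho i \subset inc i,
    forall i, #|rho i| <= 1
    & {in W, forall w, n <= #|[set j in J | w \in rho j]|}].
Proof.
move=> hallJ.
pose hits (f : I -> {set T}) S := \sum_(j in J) (f j :&: S != set0).
pose P (f : {ffun I -> {set T}}) :=
  [forall S : {set T}, (S \subset W) ==> (n * #|S| <= hits f S)] &&
  [forall j, f j \subset inc j].
have P0 : P [ffun j => inc j].
  apply/andP; split; last by apply/forallP=> j; rewrite ffunE.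
  apply/forallP=> S; apply/implyP=> /hallJ; rewrite /hits.
  by under [X in _ -> _ <= X]eq_bigr do rewrite ffunE.
case: (@arg_minnP _ _ P (fun f => \sum_j #|f j|) P0) => f /andP[/forallP hf /forallP sf] minf.
(* By minimality, removing [w] from [f i] breaks the condition at some [S], which is then tight and
   met by [f i] only in [w]. *)
have tight i w : w \in f i -> exists S : {set T}, [/\ S \subset W, i \in J,
    f i :&: S = [set w] & hits f S <= n * #|S|].
  move=> wi; pose g := [ffun j => if j == i then f i :\ w else f j].
  have gj j : j != i -> g j = f j by rewrite ffunE => /negPf ->.
  have gi : g i = f i :\ w by rewrite ffunE eqxx.
  have : ~~ P g.
    apply: contraTN isT => /minf; rewrite leqNgt.
    rewrite (bigD1 i) //= [X in _ < X](bigD1 i) //= gi (cardsD1 w (f i)) wi.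
    by rewrite (eq_bigr (fun j => #|f j|)) ?ltnSn // => j /gj ->.
  rewrite negb_and => /orP[/forallPn[S]|/forallPn[j]]; last first.
    rewrite ffunE; case: eqP => [->|_]; last by rewrite sf.
    by rewrite (subset_trans (subD1set _ _) (sf i)).
  rewrite negb_imply -ltnNge => /andP[SW ltS].
  have := hf S; rewrite SW /= => leS; exists S.
  have iJ : i \in J.
    apply: contraTT (leq_trans ltS leS) => iJ; rewrite -leqNgt /hits.
    rewrite (eq_bigr (fun j => (g j :&: S != set0) : nat)) // => j jJ.
    by rewrite gj //; apply: contraNneq iJ => <-.
  move: ltS leS; rewrite /hits (bigD1 i) //=.
  rewrite [X in _ -> _ <= X -> _](bigD1 i) //= gi.
  rewrite (eq_bigr (fun j => (f j :&: S != set0) : nat)); last by move=> j /andP[_ /gj ->].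
  have [e0|] := eqVneq ((f i :\ w) :&: S) set0; last by case: eqP => /=; lia.
  have [->|ne0] := eqVneq (f i :&: S) set0; first by move=> /=; lia.
  rewrite /= => lt1 le1; split=> //; last by rewrite (bigD1 i) //= ne0; lia.
  have {}e0 x : x \in f i :&: S -> x = w.
    rewrite inE => /andP[xf xS]; apply/eqP; apply: contraTT isT => nxw.
    by have := in_set0 x; rewrite -e0 !inE nxw xf xS.
  have /set0Pn[x xfS] := ne0; have xw := e0 x xfS; rewrite xw in xfS.
  by apply/setP=> y; rewrite [RHS]inE; apply/idP/eqP => [/e0|->].
exists f; split=> // [i|w wW].
  apply/card_le1_eqP => w1 w2 w1i w2i; apply: contraTeq isT => nw.
  have [S1 [S1W iJ i1 t1]] := tight i w1 w1i.
  have [S2 [S2W _ i2 t2]] := tight i w2 w2i.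
  have iU : f i :&: (S1 :&: S2) = set0.
    apply/setP=> x; rewrite !inE; apply: contraNF nw => /and3P[xf x1 x2].
    have : x \in f i :&: S1 by rewrite inE xf x1.
    have : x \in f i :&: S2 by rewrite inE xf x2.
    by rewrite i1 i2 !inE => /eqP <-.
  have /implyP := hf (S1 :|: S2); rewrite subUset S1W S2W => /(_ isT) hU.
  have /implyP := hf (S1 :&: S2); rewrite subIset ?S1W // => /(_ isT) hI.
  (* Strictness comes from [i]: it hits [S1], [S2] and their union, but not their intersection. *)
  have : hits f (S1 :|: S2) + hits f (S1 :&: S2) < hits f S1 + hits f S2.
    rewrite /hits -!big_split /= (bigD1 i) //= [X in _ < X](bigD1 i) //=.
    rewrite -addSn; apply: leq_add.
      rewrite iU eqxx addn0 i1 i2 -!card_gt0 !cards1 /=.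
      by case: (0 < _).
    apply: leq_sum => j _; rewrite setIUr setU_eq0 negb_and.
    have h1 : f j :&: (S1 :&: S2) != set0 -> f j :&: S1 != set0.
      by apply: contra_neq => z0; rewrite setIA z0 set0I.
    have h2 : f j :&: (S1 :&: S2) != set0 -> f j :&: S2 != set0.
      by apply: contra_neq => z0; rewrite (setIC S1) setIA z0 set0I.
    case: (f j :&: (S1 :&: S2) != set0) h1 h2 => [-> // -> //|_ _].
    by case: (_ != _); case: (_ != _).
  rewrite ltnNge => /negP[]; apply: leq_trans (leq_add t1 t2) _.
  by rewrite -mulnDr -cardsUI mulnDr leq_add.
have /implyP := hf [set w]; rewrite sub1set wW cards1 muln1 => /(_ isT) hw.
apply: leq_trans hw _; rewrite /hits -sum1_card big_mkcond [X in _ <= X]big_mkcond /=.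
apply: leq_sum => j _; rewrite inE; case: (j \in J) => //=.
case: (boolP (w \in f j)) => [_|wj]; first by case: (_ != _).
suff -> : f j :&: [set w] = set0 by rewrite eqxx.
by apply/eqP; rewrite setI_eq0 disjoint_sym disjoints1.
Qed.

(** Take [W] minimal with more than [n * #|W|] hyperedges inside. For nonempty [S], at most
    [n * #|W :\: S|] of them avoid [S], so more than [n * #|S|] meet it: this is Hall's
    condition. *)
Lemma rooted_subhypergraph (T I : finType) (n : nat) (J : {set I}) (B : {set T})
    (inc : I -> {set T}) :
  {in J, forall i, inc i \subset B} -> n * #|B| < #|J| ->
  exists (W : {set T}) (rho : I -> {set T}),
    let J' := [set j in J | inc j \subset W] in
    [/\ 0 < #|J'|, forall i, rho i \subset inc i, forall i, #|rho i| <= 1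
      & {in W, forall w, n <= #|[set j in J' | w \in rho j]|}].
Proof.
move=> incB ltB; pose edges (W : {set T}) := [set j in J | inc j \subset W].
pose P (W : {set T}) := n * #|W| < #|edges W|.
have P0 : P B.
  rewrite /P (_ : edges B = J) //; apply/setP=> j; rewrite inE.
  by have [/incB|] := boolP (j \in J).
case: (@arg_minnP _ B P (fun W => #|W|) P0) => W PW minW.
have [|rho [rho1 rho2 rho3]] := @hall_multi T I n (edges W) W inc.
  move=> S SW; have [->|S0] := eqVneq S set0; first by rewrite cards0 muln0.
  have cW : #|W :\: S| + #|S| = #|W|.
    by rewrite addnC -(cardsID S W) (setIidPr SW).
  have : #|edges (W :\: S)| <= n * #|W :\: S|.
    rewrite leqNgt; apply/negP => /minW.
    by move: S0; rewrite -card_gt0 -cW; lia.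
  have : #|edges W| <= \sum_(j in edges W) (inc j :&: S != set0) + #|edges (W :\: S)|.
    rewrite -!sum1_card big_mkcond [X in _ <= X + _]big_mkcond [X in _ <= _ + X]big_mkcond.
    rewrite -big_split /=; apply: leq_sum => j _; rewrite !inE subsetD.
    case: (j \in J) => //=; case: (inc j \subset W) => //=.
    by rewrite setI_eq0; case: [disjoint _ & _].
  by move: PW; rewrite /P -cW mulnDr; lia.
exists W, rho; split=> //.
by apply: leq_ltn_trans PW.
Qed.

(** * Colouring the square of a graph *)

Lemma leq_card_bigcup (I T : finType) (P : pred I) (F : I -> {set T}) :
  #|\bigcup_(i | P i) F i| <= \sum_(i | P i) #|F i|.
Proof.
elim/big_rec2: _ => [|i m A _ leA]; first by rewrite cards0.
by apply: leq_trans (leq_card_setU _ _) _; rewrite leq_add2l.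
Qed.

Lemma size_filter_notin (s r : seq nat) :
  uniq s -> size s <= size [seq d <- s | d \notin r] + size r.
Proof.
move=> us; rewrite -(count_predC (mem r) s) addnC size_filter leq_add2l.
rewrite -size_filter; apply: uniq_leq_size; first exact: filter_uniq.
by move=> d; rewrite mem_filter => /andP[].
Qed.

Definition sqdeg (T : finType) (e : rel T) (x : T) : nat := #|[set y | sqrel e x y]|.

Lemma sqrel_sym (T : finType) (e : rel T) : symmetric e -> symmetric (sqrel e).
Proof.
move=> se x y; rewrite /sqrel eq_sym se; congr (_ && (_ || _)).
by apply: eq_existsb => z; rewrite andbC se [e x z]se.
Qed.

Lemma sqdeg_leq_sum (T : finType) (e : rel T) (x : T) :
  symmetric e -> sqdeg e x <= \sum_(z | e x z) deg e z.
Proof.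
move=> se.
have sub : [set y | sqrel e x y] \subset
    \bigcup_(z | e x z) (z |: [set y | e z y] :\ x).
  apply/subsetP=> y; rewrite inE => /andP[nxy /orP[exy|/existsP[z /andP[exz ezy]]]];
    apply/bigcupP.
    by exists y => //; rewrite !inE eqxx.
  by exists z => //; rewrite !inE (eq_sym y x) nxy ezy orbT.
apply: leq_trans (subset_leq_card sub) _.
apply: leq_trans (leq_card_bigcup _ _) _; apply: leq_sum => z exz.
rewrite /deg (cardsD1 x [set y | e z y]) inE se exz cardsU1.
by rewrite leq_add2r; case: (_ \notin _).
Qed.

(** Conflicts come from the square of the whole graph, so a common neighbour outside [A] counts
    too. *)
Definition colours_on (T : finType) (e : rel T) (L : T -> seq nat) (A : {set T})
    (c : T -> nat) : Prop :=
  {in A, forall v, c v \in L v} /\ {in A &, forall x y, sqrel e x y -> c x != c y}.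

Lemma colours_on_add (T : finType) (e : rel T) (L : T -> seq nat) (A : {set T})
    (c : T -> nat) (x : T) :
  symmetric e -> uniq (L x) -> sqdeg e x < size (L x) ->
  colours_on e L A c -> exists c', colours_on e L (x |: A) c'.
Proof.
move=> se uL sL [cL cP]; have ss := sqrel_sym se.
pose r := [seq c y | y in [set y | sqrel e x y]].
have [d dL dr] : exists2 d, d \in L x & d \notin r.
  have := size_filter_notin r uL; rewrite size_map -cardE -/(sqdeg e x).
  case E: [seq d <- L x | d \notin r] => [|d s].
    by move=> /= h; move: (leq_trans sL h); rewrite ltnn.
  by move=> _; have := mem_head d s; rewrite -E mem_filter => /andP[]; exists d.
have dP y : sqrel e x y -> c y != d.
  move=> xy; apply: contraNneq dr => <-.
  by apply: map_f; rewrite mem_enum inE.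
exists (fun y => if y == x then d else c y); split.
  move=> y; rewrite !inE; case: (eqVneq y x) => [-> //|_ /= yA]; exact: cL.
move=> y z; rewrite !inE.
case: (eqVneq y x) => [-> _|_ /= yA]; case: (eqVneq z x) => [->|_ /= zA].
- by rewrite /sqrel eqxx.
- by move=> /dP; rewrite eq_sym.
- by rewrite ss => _ /dP.
- exact: cP.
Qed.

Lemma colours_on_greedy (T : finType) (e : rel T) (L : T -> seq nat)
    (A Q : {set T}) (c : T -> nat) :
  symmetric e -> {in Q, forall x, uniq (L x) /\ sqdeg e x < size (L x)} ->
  colours_on e L A c -> exists c', colours_on e L (A :|: Q) c'.
Proof.
move=> se; have [m] := ubnP #|Q|; elim: m A Q c => // m IHm A Q c leQ HQ cA.
have [->|[x xQ]] := set_0Vmem Q; first by exists c; rewrite setU0.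
have [uL sL] := HQ x xQ; have [c1 cx] := colours_on_add se uL sL cA.
have [||c2 c2P] := IHm (x |: A) (Q :\ x) c1 _ _ cx.
- by move: leQ; rewrite (cardsD1 x Q) xQ.
- by move=> y; rewrite !inE => /andP[_ /HQ].
- by exists c2; rewrite -(setD1K xQ) setUCA setUA.
Qed.

(** The vertices of [Q] remain, isolated, so that the type and the lists survive the induction. *)
Definition del (T : finType) (Q : {set T}) (e : rel T) : rel T :=
  fun x y => [&& x \notin Q, y \notin Q & e x y].

(** A conflict can only get lost on a path through [Q], and a vertex of [Q] has at most one
    neighbour outside [U]. *)
Lemma colours_on_del (T : finType) (e : rel T) (L : T -> seq nat) (U Q : {set T})
    (c : T -> nat) :
  Q \subset U ->
  (forall z p q, z \in Q -> p \notin U -> q \notin U -> e p z -> e z q -> p = q) ->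
  colours_on (del Q e) L setT c -> colours_on e L (~: U) c.
Proof.
move=> QU Q1 [cL cP]; split=> [x _|x y]; first exact: cL.
have nQ z : z \notin U -> z \notin Q by apply: contra => /(subsetP QU).
rewrite !inE => xU yU xy; apply: cP; rewrite ?inE //.
move: xy => /andP[nxy xy]; rewrite /sqrel nxy /=; apply/orP.
case/orP: xy => [exy|/existsP[z /andP[exz ezy]]].
  by left; rewrite /del exy !nQ.
right; apply/existsP; exists z; rewrite /del exz ezy (nQ x xU) (nQ y yU) /= !andbT andbb.
have [zQ|//] := boolP (z \in Q).
by move: nxy; rewrite (Q1 z x y zQ xU yU exz ezy) eqxx.
Qed.

Lemma reduce_free (T : finType) (e : rel T) (L : T -> seq nat) (U Q : {set T})
    (c : T -> nat) :
  symmetric e -> Q \subset U ->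
  (forall z p q, z \in Q -> p \notin U -> q \notin U -> e p z -> e z q -> p = q) ->
  {in U, forall x, uniq (L x) /\ sqdeg e x < size (L x)} ->
  colours_on (del Q e) L setT c -> exists c', colours_on e L setT c'.
Proof.
move=> se QU Q1 HU /(colours_on_del QU Q1) cU.
have [c' c'P] := colours_on_greedy se HU cU; exists c'.
by rewrite setUC setUCr in c'P.
Qed.

(* A vertex [y] of [U] sees outside [U :|: V] only the closed neighbourhood of
   [w y], so it keeps as many free colours as [U] has vertices at [w y]. *)
Lemma reduce_rooted (T : finType) (e : rel T) (L : T -> seq nat) (k n : nat)
    (U V : {set T}) (w b : T -> T) (rt : pred T) (c : T -> nat) :
  symmetric e ->
  (forall x, deg e x <= k) ->
  (forall x, uniq (L x) /\ size (L x) = k.+1) ->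
  {in U, forall y, [/\ y \notin V, w y \notin U, w y \notin V & e y (w y)]} ->
  {in U, forall y u, e y u -> u = w y \/ u \in V} ->
  {in V, forall v y, e v y -> y \in U} ->
  {in V, forall v y y', e v y -> e v y' -> b y = b y'} ->
  {in V, forall v, sqdeg e v <= k} ->
  {in U &, forall x y, rt x -> rt y -> b x = b y -> x = y} ->
  {in U, forall x, #|[set y in U | b y == b x]| <= n} ->
  {in U, forall x, n <= #|[set y in U | (w y == w x) && rt y]|} ->
  colours_on (del V e) L setT c -> exists c', colours_on e L setT c'.
Proof.
move=> se dk HL Uw UN VN Vb Vk rt1 bn wn cV.
have {cV} cUV : colours_on e L (~: (U :|: V)) c.
  apply: colours_on_del cV; first exact: subsetUr.
  move=> z p q zV; rewrite !inE negb_or => /andP[pU _] _ epz _.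
  by rewrite (VN z zV p) // se in pU.
have wU y y' : y \in U -> y' \in U -> e (w y) y' -> w y' = w y.
  move=> yU y'U; rewrite se => /(UN y' y'U)[//|wV].
  by have [_ _ /negP] := Uw y yU.
pose N y := (w y |: [set z | e (w y) z]) :\: U.
pose L' y := [seq d <- L y | d \notin [seq c z | z in N y]].
have [y yU|c1 [c1L c1P]] := @galvin_rooted T T T w b n rt U L' rt1 bn wn.
  have [uL sL] := HL y; split; first exact: filter_uniq.
  have := size_filter_notin [seq c z | z in N y] uL.
  rewrite sL size_map -cardE -/(L' y) => sz.
  (* The closed neighbourhood of [w y] has at most [k.+1] vertices and contains, besides [N y],
     every vertex of [U] attached to [w y]. *)
  have : #|[set y' in U | w y' == w y]| + #|N y| <= k.+1.
    apply: leq_trans (_ : #|w y |: [set z | e (w y) z]| <= _); last first.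
      by rewrite cardsU1 -add1n leq_add //; [case: (_ \notin _) | apply: dk].
    rewrite -(cardsID U (w y |: _)) leq_add2r; apply: subset_leq_card.
    apply/subsetP=> y'; rewrite !inE => /andP[y'U /eqP ww]; rewrite y'U andbT.
    by have [_ _ _] := Uw y' y'U; rewrite ww se => ->; rewrite orbT.
  by move=> h; rewrite -(leq_add2r #|N y|); apply: leq_trans h sz.
pose c2 x := if x \in U then c1 x else c x.
have mixed x y : x \in U -> y \notin U -> y \notin V -> sqrel e x y -> c1 x != c y.
  move=> xU yU yV /andP[_ xy].
  suff yN : y \in N x.
    have := c1L x xU; rewrite mem_filter => /andP[+ _].
    by apply: contraNneq => ->; apply: map_f; rewrite mem_enum.
  rewrite !inE yU /=; case/orP: xy => [/(UN x xU)[->|yV']|/existsP[z /andP[exz ezy]]].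
  - by rewrite eqxx.
  - by rewrite yV' in yV.
  have [zw|zV] := UN x xU z exz; first by rewrite -zw ezy orbT.
  by rewrite (VN z zV y ezy) in yU.
have c2P : colours_on e L (~: V) c2.
  have [cL cP] := cUV; split=> [x|x y].
    rewrite inE /c2 => xV; have [xU|xU] := boolP (x \in U).
      by have := c1L x xU; rewrite mem_filter => /andP[].
    by apply: cL; rewrite !inE negb_or xU.
  rewrite !inE /c2 => xV yV xy.
  have [xU|xU] := boolP (x \in U); have [yU|yU] := boolP (y \in U).
  (* Two vertices of [U] conflict only through a common hub or a common vertex of [V]; either way
     they share an end as edges of the multigraph. *)
  - move: (xy) => /andP[nxy /orP[exy|/existsP[z /andP[exz ezy]]]].
      have [yw|yV'] := UN x xU y exy; last by rewrite yV' in yV.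
      by have [_ /negP] := Uw x xU; rewrite -yw.
    apply: c1P => //; have [zw|zV] := UN x xU z exz.
      by rewrite (wU x y) ?eqxx // -zw.
    by rewrite (Vb z zV x y) ?eqxx ?orbT // se.
  - exact: mixed.
  - by rewrite eq_sym; apply: mixed => //; rewrite sqrel_sym.
  - by apply: cP; rewrite ?inE ?negb_or ?xU ?yU.
have [|c' c'P] := @colours_on_greedy T e L (~: V) V c2 se _ c2P.
  by move=> x xV; have [uL ->] := HL x; split=> //; rewrite ltnS Vk.
by exists c'; rewrite setUC setUCr in c'P.
Qed.

(** * Threads and clusters *)

Section Structure.
Variables (T : finType) (e : rel T) (M n : nat).
Hypothesis se : symmetric e.

Definition big_vertex (x : T) := M <= deg e x.
Definition bigdeg (x : T) := #|[set z | e x z && big_vertex z]|.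
Definition smalldeg (x : T) := #|[set z | e x z && ~~ big_vertex z]|.
Definition bigs : {set T} := [set x | big_vertex x].

Definition threads : {set T} := [set v | (deg e v == 2) && (bigdeg v == 0)].
Definition monos : {set T} := [set y | ~~ big_vertex y && (bigdeg y == 1)].

Definition linked : rel T := fun y y' =>
  [&& y \in monos, y' \in monos & [exists v in threads, e y v && e v y']].
(* A cluster is named by the canonical representative [root linked y] of its
   members; [cluster r] is empty when [r] is not a representative. *)
Definition cluster (r : T) : {set T} := [set y in monos | root linked y == r].
(* All edges leaving a vertex of the cluster go to its hub or to threads of the
   cluster. *)
Definition closed_cluster (r : T) : bool :=
  [forall y in cluster r, forall u, e y u && ~~ big_vertex u ==>
     (u \in threads) && [forall y', e u y' ==> (y' \in monos)]].
Definition tight_clusters : {set T} :=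
  [set r in monos | [&& root linked r == r, closed_cluster r & #|cluster r| <= n]].

Lemma degE x : deg e x = bigdeg x + smalldeg x.
Proof.
rewrite /deg -(cardsID [set z | big_vertex z]); congr (_ + _); apply: eq_card => z.
  by rewrite !inE.
by rewrite !inE andbC.
Qed.

Lemma linked_sym : symmetric linked.
Proof.
move=> y y'; rewrite /linked andbCA; congr [&& _, _ & _].
by apply: eq_existsb => v; rewrite !(se v) !(se _ v) [e v y && _]andbC.
Qed.

Lemma linked_connect_sym : connect_sym linked.
Proof. exact/sym_connect_sym/linked_sym. Qed.

Lemma root_linked y y' : linked y y' -> root linked y = root linked y'.
Proof. by move=> yy'; apply/eqP; rewrite (root_connect linked_connect_sym) connect1. Qed.

Lemma linked_thread v y y' : v \in threads -> y \in monos -> y' \in monos ->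
  e v y -> e v y' -> linked y y'.
Proof.
move=> vZ yY y'Y vy vy'; rewrite /linked yY y'Y; apply/existsP; exists v.
by rewrite vZ se vy.
Qed.

Lemma root_monos y : y \in monos -> root linked y \in monos.
Proof.
have cl : closed linked monos by move=> a b /and3P[-> ->].
by rewrite (closed_connect cl (connect_root linked y)).
Qed.

Lemma thread_small v y : v \in threads -> e v y -> ~~ big_vertex y.
Proof.
rewrite inE => /andP[_ /eqP/cards0_eq b0] vy; apply/negP => yb.
by have := in_set0 y; rewrite -b0 inE vy yb.
Qed.

Lemma small_threads v : 2 < M -> v \in threads -> ~~ big_vertex v.
Proof. by rewrite inE => M2 /andP[/eqP dv _]; rewrite /big_vertex dv -ltnNge. Qed.

Lemma thread_nbr v : v \in threads -> exists y, e v y.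
Proof.
rewrite inE => /andP[/eqP dv _]; have : 0 < deg e v by rewrite dv.
by case/card_gt0P=> y; rewrite inE; exists y.
Qed.

Lemma thread_nbrs v y y' z : v \in threads -> y != y' -> e v y -> e v y' -> e v z ->
  z = y \/ z = y'.
Proof.
rewrite inE => /andP[/eqP dv _] nyy vy vy' vz.
have : [set y; y'] = [set u | e v u].
  apply/eqP; rewrite eqEcard; apply/andP; split.
    by apply/subsetP=> u; rewrite !inE => /orP[]/eqP ->.
  by rewrite cards2 nyy -/(deg e v) dv.
by move/setP/(_ z); rewrite !inE vz => /orP[]/eqP ->; [left|right].
Qed.

(** The default [y] does not occur on [monos], whose members have a big neighbour. *)
Definition hub (y : T) : T := odflt y [pick z | e y z && big_vertex z].

Lemma hubP y : y \in monos -> e y (hub y) /\ big_vertex (hub y).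
Proof.
rewrite inE => /andP[_ /eqP b1]; rewrite /hub; case: pickP => [z /andP[] //|no].
have : 0 < bigdeg y by rewrite b1.
by case/card_gt0P=> z; rewrite inE no.
Qed.

Lemma hub_uniq y u : y \in monos -> e y u -> big_vertex u -> u = hub y.
Proof.
move=> yY yu ub; have [yh hb] := hubP yY; move: yY; rewrite inE => /andP[_ /eqP b1].
have /card_le1_eqP : bigdeg y <= 1 by rewrite b1.
by apply; rewrite inE ?yu ?yh.
Qed.

Lemma in_cluster y r : (y \in cluster r) = (y \in monos) && (root linked y == r).
Proof. by rewrite inE. Qed.

Lemma closed_clusterP r y u : closed_cluster r -> y \in cluster r -> e y u ->
  ~~ big_vertex u -> u \in threads /\ (forall y', e u y' -> y' \in cluster r).
Proof.
move=> /forall_inP cr yr yu ub; have /forallP/(_ u) := cr y yr.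
rewrite yu ub => /andP[uZ /forallP uY]; split=> // y' uy'.
have y'Y : y' \in monos by have := uY y'; rewrite uy'.
move: yr; rewrite !in_cluster => /andP[yY /eqP <-]; rewrite y'Y eq_sym.
by apply/eqP/root_linked/(linked_thread uZ) => //; rewrite se.
Qed.

Lemma tight_clusterP r : r \in tight_clusters ->
  [/\ r \in cluster r, closed_cluster r & #|cluster r| <= n].
Proof. by rewrite inE => /and4P[rY rr cr nr]; rewrite in_cluster rY rr. Qed.

(** Tight clusters are the hyperedges of a hypergraph on the big vertices. The clusters in the
    rooted subhypergraph are uncoloured together with their threads and handed to
    [reduce_rooted]. *)
Lemma reduce_tight_clusters (L : T -> seq nat) (k : nat) :
  2 < M -> M * 2 <= k ->
  (forall x, deg e x <= k) -> (forall x, deg e x != 1) ->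
  (forall x, uniq (L x) /\ size (L x) = k.+1) ->
  (forall (Q : {set T}) x, x \in Q -> 0 < deg e x -> exists c, colours_on (del Q e) L setT c) ->
  n * #|bigs| < #|tight_clusters| -> exists c, colours_on e L setT c.
Proof.
move=> M2 Mk dk d1 HL IH ltI; pose inc r := hub @: cluster r.
have incB : {in tight_clusters, forall r, inc r \subset bigs}.
  move=> r _; apply/subsetP=> w /imsetP[y]; rewrite in_cluster => /andP[yY _] ->.
  by have [_ hb] := hubP yY; rewrite inE.
have [W [rho []]] := rooted_subhypergraph incB ltI.
set J := [set j in _ | _] => J0 rho_inc rho1 rhoW.
have JP r : r \in J -> r \in tight_clusters /\ inc r \subset W.
  by rewrite inE => /andP.
(* The root of a cluster is a member attached to the hub that [rho] assigns to the cluster, if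
   any. *)
pose rtf r := [pick y in cluster r | hub y \in rho r].
pose rt y := rtf (root linked y) == Some y.
pose U := [set y in monos | root linked y \in J].
have inU y : (y \in U) = (y \in monos) && (root linked y \in J) by rewrite inE.
pose V := [set v in threads | [exists y in U, e v y]].
have VP v : v \in V -> [/\ v \in threads & exists2 r, r \in J &
    forall y, e v y -> y \in cluster r].
  rewrite inE => /andP[vZ /existsP[y /andP[]]]; rewrite inU => /andP[yY yJ] vy.
  split=> //; exists (root linked y) => // y' vy'.
  have [/tight_clusterP[_ cl _] _] := JP _ yJ.
  have [|//|_ clv] := closed_clusterP cl (y := y) (u := v) _ _ (small_threads M2 vZ).
  - by rewrite in_cluster yY eqxx.
  - by rewrite se.
  - exact: clv.
have UZ y u : y \in U -> e y u -> ~~ big_vertex u -> u \in V.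
  move=> yU yu ub; rewrite inE; apply/andP; split; last first.
    by apply/existsP; exists y; rewrite yU se.
  move: yU; rewrite inU => /andP[yY yJ]; have [/tight_clusterP[_ cl _] _] := JP _ yJ.
  by have [|//] := closed_clusterP cl _ yu ub; rewrite in_cluster yY eqxx.
have /card_gt0P[r rJ] := J0.
have rC : r \in cluster r by have [/tight_clusterP[]] := JP r rJ.
have rU : r \in U by move: rC; rewrite in_cluster inU => /andP[-> /eqP ->].
(* As no degree is 1, [r] has a neighbour besides its hub; so [V] is nonempty and deleting it
   removes edges. *)
have [u uV] : exists u, u \in V.
  move: rC; rewrite in_cluster inE => /andP[/andP[_ /eqP b1] _].
  have : 0 < smalldeg r by have := d1 r; rewrite degE b1 add1n eqSS lt0n.
  by case/card_gt0P=> u; rewrite inE => /andP[ru ub]; exists u; apply: (UZ r).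
have [|c cP] := IH V u uV.
  by have [uZ _] := VP u uV; move: uZ; rewrite inE => /andP[/eqP ->].
apply: (reduce_rooted (n := n) (U := U) (w := hub) (b := root linked) (rt := rt) se dk HL
          _ _ _ _ _ _ _ _ cP).
- move=> y; rewrite inU => /andP[yY _]; have [yh hb] := hubP yY; split=> //.
  + apply/negP => /VP[yZ _]; move: yY yZ; rewrite !inE => /andP[_ /eqP ->].
    by rewrite andbF.
  + by rewrite inU inE hb.
  + by apply/negP => /VP[/(small_threads M2)]; rewrite hb.
- move=> y yU u' yu'; have [ub|ub] := boolP (big_vertex u').
    by left; apply: hub_uniq => //; move: yU; rewrite inU => /andP[].
  by right; apply: (UZ y).
- move=> v /VP[vZ [r' r'J vr]] y /vr; rewrite in_cluster inU => /andP[-> /eqP ->] //.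
- move=> v /VP[vZ [r' r'J vr]] y y' /vr + /vr.
  by rewrite !in_cluster => /andP[_ /eqP ->] /andP[_ /eqP ->].
- move=> v /VP[vZ _]; apply: leq_trans (sqdeg_leq_sum v se) _.
  apply: leq_trans Mk; rewrite mulnC.
  have -> : 2 = #|[set z | e v z]| by move: vZ; rewrite inE => /andP[/eqP <-].
  rewrite -sum_nat_const big_mkcond [X in _ <= X]big_mkcond; apply: leq_sum => z _.
  rewrite inE; case: ifP => // vz; apply: ltnW.
  by have := thread_small vZ vz; rewrite /big_vertex -ltnNge.
- by move=> x y _ _ /eqP rx /eqP ry xy; move: rx; rewrite xy ry => -[].
- move=> x; rewrite inU => /andP[_ /JP[/tight_clusterP[_ _ le] _]].
  apply: leq_trans le; apply: subset_leq_card; apply/subsetP=> y.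
  by rewrite inE inU in_cluster => /andP[/andP[-> _]].
move=> x; rewrite inU => /andP[xY xJ].
have hW : hub x \in W.
  have [_ /subsetP] := JP _ xJ; apply; apply: imset_f.
  by rewrite in_cluster xY eqxx.
apply: leq_trans (rhoW _ hW) _.
have rtfP j : j \in [set j in J | hub x \in rho j] -> exists y,
    [/\ rtf j = Some y, y \in cluster j & hub y = hub x].
  rewrite inE => /andP[jJ hj]; rewrite /rtf; case: pickP => [y /andP[yj hy]|no].
    by exists y; split=> //; have /card_le1_eqP := rho1 j; apply.
  have /imsetP[y yj hy] := subsetP (rho_inc j) _ hj.
  by have := no y; rewrite yj -hy hj.
(* Roots of different clusters differ, so [hub x] has as many roots as clusters assigned to it. *)
rewrite -(card_in_imset (f := fun j => odflt j (rtf j))); last first.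
  move=> i j /rtfP[y [-> yi _]] /rtfP[z [-> zj _]] /= yz.
  by move: yi zj; rewrite yz !in_cluster => /andP[_ /eqP <-] /andP[_ /eqP].
apply: subset_leq_card; apply/subsetP=> y /imsetP[j jJ ->].
have [z [zj zc hz]] := rtfP j jJ; rewrite zj /=.
move: zc; rewrite in_cluster inE inU hz eqxx /= => /andP[zY /eqP rz].
by rewrite zY /rt rz zj eqxx andbT; move: jJ; rewrite inE => /andP[].
Qed.

(** * Discharging *)

Definition inner_threads (A : {set T}) : {set T} :=
  [set v in threads | [set y | e v y] \subset A].

Lemma in_inner_threads A v : v \in inner_threads A ->
  v \in threads /\ (forall y, e v y -> y \in A).
Proof. by rewrite inE => /andP[vZ /subsetP vA]; split=> // y vy; apply: vA; rewrite inE. Qed.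

(* A cluster is connected: growing it vertex by vertex gains a thread each time. *)
Lemma card_cluster_leq r : r \in cluster r ->
  #|cluster r| <= #|inner_threads (cluster r)|.+1.
Proof.
move=> rC; pose P (A : {set T}) :=
  [&& r \in A, A \subset cluster r & #|A| <= #|inner_threads A|.+1].
have P0 : P [set r] by rewrite /P set11 sub1set rC cards1.
case: (@arg_maxnP _ [set r] P (fun A => #|A|) P0) => A /and3P[rA AC leA] maxA.
suff -> : cluster r = A by [].
apply/eqP; rewrite eqEsubset AC andbT; apply/negPn/negP => nCA.
have [noexit|] := boolP [forall y in A, forall y', linked y y' ==> (y' \in A)].
  case/negP: nCA; apply/subsetP=> y; rewrite in_cluster => /andP[_ /eqP ry].
  have cl : closed linked A.
    apply: (intro_closed linked_connect_sym) => a b ab aA.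
    by move/forall_inP: noexit => /(_ a aA)/forallP/(_ b); rewrite ab.
  rewrite -(closed_connect cl (x := r)) // linked_connect_sym -ry.
  exact: connect_root.
rewrite negb_forall => /existsP[y]; rewrite negb_imply => /andP[yA /forallPn[y']].
rewrite negb_imply => /andP[lyy' y'A].
have /and3P[yY y'Y /existsP[v /and3P[vZ yv vy']]] := lyy'.
have nyy : y != y' by apply: contraNneq y'A => <-.
have : P (y' |: A).
  apply/and3P; split.
  - by rewrite inE rA orbT.
  - rewrite subUset AC andbT sub1set in_cluster y'Y -(root_linked lyy').
    by have := subsetP AC y yA; rewrite in_cluster => /andP[].
  rewrite cardsU1 y'A add1n ltnS; apply: leq_trans leA _.
  apply: proper_card; apply/properP; split.
    apply/subsetP=> u /in_inner_threads[uZ uA]; rewrite inE uZ.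
    by apply/subsetP=> z; rewrite !inE => /uA ->; rewrite orbT.
  exists v; last by apply: contra y'A => /in_inner_threads[_]; apply.
  rewrite inE vZ; apply/subsetP=> z; rewrite !inE => vz.
  have vy : e v y by rewrite se.
  by have [->|->] := thread_nbrs vZ nyy vy vy' vz; rewrite ?yA ?eqxx ?orbT.
by move/maxA; rewrite /= cardsU1 y'A leqNgt ltnSn.
Qed.

(** Count the edges from the cluster to small vertices at their small ends. Each inner thread
    absorbs two; a violation of closedness gives another edge, ending at a vertex that is not an
    inner thread. *)
Lemma sum_smalldeg_cluster r : 2 < M ->
  #|inner_threads (cluster r)| * 2 + ~~ closed_cluster r <=
  \sum_(y in cluster r) smalldeg y.
Proof.
move=> M2; set C := cluster r; set Z := inner_threads C.
pose f u := #|[set y in C | e y u]|.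
have -> : \sum_(y in C) smalldeg y = \sum_(u | ~~ big_vertex u) f u.
  rewrite (eq_bigr (fun y => \sum_(u | ~~ big_vertex u) (e y u : nat))).
    rewrite exchange_big; apply: eq_bigr => u _.
    rewrite /f -sum1_card big_mkcond [RHS]big_mkcond; apply: eq_bigr => y _.
    by rewrite inE; case: (y \in C); case: (e y u).
  move=> y _; rewrite /smalldeg -sum1_card big_mkcond [RHS]big_mkcond.
  by apply: eq_bigr => u _; rewrite inE; case: (big_vertex u); case: (e y u).
have f2 u : u \in Z -> 2 <= f u.
  move=> /in_inner_threads[uZ uC]; rewrite /f.
  have /andP[/eqP <- _] : (deg e u == 2) && (bigdeg u == 0) by move: uZ; rewrite inE.
  apply: subset_leq_card; apply/subsetP=> y; rewrite inE => uy.
  by rewrite inE (uC y uy) se.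
have sZ u : u \in Z -> ~~ big_vertex u by move=> /in_inner_threads[/(small_threads M2)].
have -> : #|Z| * 2 = \sum_(u | ~~ big_vertex u) (u \in Z) * 2.
  rewrite -sum_nat_const big_mkcond [RHS]big_mkcond; apply: eq_bigr => u _.
  by have [/sZ ->|_] := boolP (u \in Z); rewrite ?if_same.
have [cr|] := boolP (closed_cluster r).
  rewrite addn0; apply: leq_sum => u _.
  by have [/f2|] := boolP (u \in Z).
rewrite negb_forall => /existsP[y]; rewrite negb_imply => /andP[yC /forallPn[u]].
rewrite negb_imply => /andP[/andP[yu ub] nu].
have uZ : u \notin Z.
  apply: contra nu => /in_inner_threads[-> uC]; apply/forallP=> y'.
  by apply/implyP=> /uC; rewrite in_cluster => /andP[].
rewrite (bigD1 u) //= [X in _ <= X](bigD1 u) //= (negPf uZ) mul0n add0n addnC.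
apply: leq_add; first by apply/card_gt0P; exists y; rewrite inE yC.
apply: leq_sum => z _; by have [/f2|] := boolP (z \in Z).
Qed.

(** With charges scaled by [n], a member with [s] small neighbours has surplus [n * s - n] and an
    inner thread needs [p]. For [c] members and [z] inner threads the balance is at least
    [(n + 1) * z - n * c], plus [n] if the cluster is not closed. As [c <= z + 1], it is negative
    only for tight clusters, and never below [- n]. *)
Lemma cluster_charge p r : 2 < M -> n = p.+1 -> r \in cluster r ->
  p * #|inner_threads (cluster r)| + n * #|cluster r| <=
  n * (\sum_(y in cluster r) smalldeg y) + n * (r \in tight_clusters).
Proof.
move=> M2 np rC; have := card_cluster_leq rC; have := sum_smalldeg_cluster r M2.
have -> : (r \in tight_clusters) = closed_cluster r && (#|cluster r| <= n).
  by move: rC; rewrite in_cluster => /andP[rY rr]; rewrite inE rY rr.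
set z := #|_|; set c := #|_|; set s := \sum_(_ in _) _; rewrite np.
by case: closed_cluster; case: (leqP c p.+1) => /=; nia.
Qed.

Lemma clusters_charge p : 2 < M -> n = p.+1 ->
  p * #|inner_threads monos| + n * #|monos| <=
  n * (\sum_(y in monos) smalldeg y) + n * #|tight_clusters|.
Proof.
move=> M2 np; pose R := [set r | r \in cluster r].
have rootR y : y \in monos -> root linked y \in R.
  by move=> yY; rewrite inE in_cluster root_monos //= (root_root linked_connect_sym).
have part (F : T -> nat) : \sum_(y in monos) F y = \sum_(r in R) \sum_(y in cluster r) F y.
  rewrite (partition_big (root linked) (fun r => r \in R)) //=.
  by apply: eq_bigr => r _; apply: eq_bigl => y; rewrite in_cluster.
have -> : #|tight_clusters| = \sum_(r in R) (r \in tight_clusters).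
  rewrite -sum1_card big_mkcond [RHS]big_mkcond; apply: eq_bigr => r _.
  have [/tight_clusterP[rC _ _]|_] := boolP (r \in tight_clusters); last by rewrite if_same.
  by rewrite inE rC.
have -> : #|monos| = \sum_(r in R) #|cluster r|.
  by rewrite -sum1_card part; apply: eq_bigr => r _; rewrite sum1_card.
(* The ends of a thread inner to [monos] are linked, so they lie in one cluster. *)
have leZ : #|inner_threads monos| <= \sum_(r in R) #|inner_threads (cluster r)|.
  apply: leq_trans (leq_card_bigcup _ _); apply: subset_leq_card.
  apply/subsetP=> v /in_inner_threads[vZ vY]; have [y vy] := thread_nbr vZ.
  apply/bigcupP; exists (root linked y); first exact/rootR/vY.
  rewrite inE vZ; apply/subsetP=> y'; rewrite inE => vy'; rewrite in_cluster vY //=.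
  by apply/eqP/root_linked/(linked_thread vZ); rewrite ?vY.
apply: leq_trans (leq_add (leq_mul (leqnn p) leZ) (leqnn _)) _.
rewrite part !big_distrr -!big_split /=; apply: leq_sum => r; rewrite inE => rC.
exact: cluster_charge.
Qed.

Definition multis : {set T} := [set x | ~~ big_vertex x && (1 < bigdeg x)].

(** An end outside [monos] is small and has a big neighbour, hence at least two, and it counts the
    thread in its [smalldeg]. *)
Lemma card_outer_threads : 2 < M ->
  {in threads, forall v x, e v x -> 0 < bigdeg x} ->
  #|threads| <= #|inner_threads monos| + \sum_(x in multis) smalldeg x.
Proof.
move=> M2 Zb; rewrite -(cardsID (inner_threads monos) threads) leq_add //.
  exact/subset_leq_card/subsetIr.
apply: leq_trans (leq_card_bigcup _ _); apply: subset_leq_card.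
apply/subsetP=> v; rewrite inE => /andP[+ vZ]; rewrite inE vZ => /subsetPn[x].
rewrite inE => vx xY; apply/bigcupP; exists x; last first.
  by rewrite inE se vx small_threads.
have xb := thread_small vZ vx; have := Zb v vZ x vx; move: xY.
by rewrite !inE xb /=; case: (bigdeg x) => [|[]].
Qed.

Lemma sum_bigdeg_leq (A : {set T}) :
  \sum_(x in A) bigdeg x <= \sum_(w in bigs) deg e w.
Proof.
rewrite (eq_bigr (fun x => \sum_(w in bigs) (e x w : nat))).
  rewrite exchange_big; apply: leq_sum => w _.
  rewrite /deg -sum1_card big_mkcond [X in _ <= X]big_mkcond; apply: leq_sum => x _.
  by rewrite inE se; case: (x \in A); case: (e w x).
move=> x _; rewrite /bigdeg -sum1_card big_mkcond [RHS]big_mkcond.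
by apply: eq_bigr => w _; rewrite !inE; case: (big_vertex w); case: (e x w).
Qed.

(** Scaled by [n], the demand is [3 * n - 1 = 3 * p + 2]. A big vertex sends [p] along each edge and
    keeps 1 per edge, so at least [M]: here [3 * n] covers its own demand and [n * n] pays [n] to
    each of [n] tight clusters. *)
Lemma dense_of_irreducible p : n = p.+1 -> 3 * n + n * n <= M ->
  (forall x, deg e x != 1) ->
  {in threads, forall v x, e v x -> 0 < bigdeg x} ->
  #|tight_clusters| <= n * #|bigs| ->
  (3 * p + 2) * #|[set x | 0 < deg e x]| <= n * \sum_(x | 0 < deg e x) deg e x.
Proof.
move=> np leM d1 Zb leI; have M2 : 2 < M by rewrite np in leM; lia.
have := clusters_charge M2 np; have := card_outer_threads M2 Zb.
pose S := [set x | (0 < deg e x) && ~~ big_vertex x].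
have -> : #|[set x | 0 < deg e x]| = #|bigs| + #|S|.
  rewrite -(cardsID bigs); congr (_ + _); apply: eq_card => x; rewrite !inE.
    by rewrite /big_vertex; case: (leqP M (deg e x)); rewrite ?andbF ?andbT //; lia.
  by rewrite andbC.
have -> : \sum_(x | 0 < deg e x) deg e x =
    \sum_(x in bigs) deg e x + (\sum_(x in S) bigdeg x + \sum_(x in S) smalldeg x).
  rewrite -big_split /= (bigID (mem bigs)) /=; congr (_ + _).
    apply: eq_bigl => x; rewrite !inE /big_vertex.
    by case: (leqP M (deg e x)); rewrite ?andbF ?andbT //; lia.
  by apply: eq_big => x; [rewrite !inE | rewrite degE].
have := sum_bigdeg_leq S.
have : M * #|bigs| <= \sum_(x in bigs) deg e x.
  by rewrite mulnC -sum_nat_const; apply: leq_sum => x; rewrite inE.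
(* This holds vertex by vertex; [2 * p + 1] is [n] for the edge itself plus [p] received along it.
   Members of [multis] can spare [n] for each small neighbour, and a vertex without big neighbours
   that is no thread has degree at least 3. *)
have : (3 * p + 2) * #|S| + n * (\sum_(y in monos) smalldeg y)
    + n * (\sum_(y in multis) smalldeg y) <=
  (2 * p + 1) * (\sum_(x in S) bigdeg x) + n * (\sum_(x in S) smalldeg x)
    + p * #|threads| + n * #|monos|.
  have sub (A : {set T}) (F : T -> nat) : A \subset S ->
      \sum_(x in A) F x = \sum_(x in S) (x \in A) * F x.
    move=> /subsetP AS; rewrite big_mkcond [RHS]big_mkcond; apply: eq_bigr => x _.
    by have [/AS ->|_] := boolP (x \in A); rewrite ?mul1n ?if_same.
  have ZS : threads \subset S.
    apply/subsetP=> v vZ; rewrite inE small_threads // andbT.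
    by move: vZ; rewrite inE => /andP[/eqP ->].
  have YS : monos \subset S.
    by apply/subsetP=> y; rewrite !inE => /andP[-> /eqP b1]; rewrite degE b1.
  have XS : multis \subset S.
    apply/subsetP=> y; rewrite !inE => /andP[-> b1]; rewrite degE andbT.
    exact: leq_trans (ltnW b1) (leq_addr _ _).
  rewrite -[#|S|]sum1_card -[#|threads|]sum1_card -[#|monos|]sum1_card.
  rewrite !(sub _ _ YS) (sub _ _ XS) (sub _ _ ZS) !big_distrr -!big_split /=.
  apply: leq_sum => x; rewrite !inE => /andP[+ xb]; rewrite xb /=.
  have := d1 x; rewrite degE np.
  by case: (bigdeg x) => [|[|b]] /=; case: (smalldeg x) => [|[|[|s]]] //=; nia.
move: leM leI; rewrite np.
set B := #|bigs|; set I := #|tight_clusters|; set z := #|inner_threads monos|.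
set z' := #|threads|; set sX := \sum_(_ in multis) _.
set sb := \sum_(x in S) bigdeg x; set sB := \sum_(_ in bigs) _.
move=> leM leI h1 h2 h3 h4 h5.
have h6 : p.+1 * I <= p.+1 * (p.+1 * B) by rewrite leq_mul2l leI orbT.
have h7 : (3 * p.+1 + p.+1 * p.+1) * B <= M * B by rewrite leq_mul2r leM orbT.
have h8 : p * sb <= p * sB by rewrite leq_mul2l h3 orbT.
have h9 : p * z' <= p * (z + sX) by rewrite leq_mul2l h4 orbT.
lia.
Qed.

End Structure.

(** * Colouring sparse graphs *)

Definition arcs (T : finType) (e : rel T) (S : {set T}) : {set T * T} :=
  [set a | [&& a.1 \in S, a.2 \in S & e a.1 a.2]].

Lemma sum_deg_leq_arcs (T : finType) (e : rel T) : symmetric e ->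
  \sum_(x | 0 < deg e x) deg e x <= #|arcs e [set x | 0 < deg e x]|.
Proof.
move=> se; have dpos x y : e x y -> 0 < deg e x.
  by move=> xy; apply/card_gt0P; exists y; rewrite inE.
rewrite (eq_bigr (fun x => \sum_(y | e x y) 1)); last first.
  by move=> x _; rewrite sum1_card /deg; apply: eq_card => y; rewrite !inE.
rewrite pair_big_dep /= sum1_card; apply: subset_leq_card; apply/subsetP=> -[x y].
by rewrite !inE /= => /andP[-> xy]; rewrite xy andbT (dpos y x) // se.
Qed.

Lemma sqdeg_leq_mul (T : finType) (e : rel T) (x : T) (m : nat) : symmetric e ->
  (forall z, e x z -> deg e z <= m) -> sqdeg e x <= deg e x * m.
Proof.
move=> se dm; apply: leq_trans (sqdeg_leq_sum x se) _.
rewrite /deg -sum_nat_const [X in _ <= X](eq_bigl (fun z => e x z)) => [|z].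
  exact: leq_sum.
by rewrite inE.
Qed.

(** The bound [k] stays fixed while edges are deleted, so the lists keep their size. It is at least
    [M * M] because a small vertex with only small neighbours sees at most that many vertices in the
    square. *)
Lemma sparse_colourable (T : finType) (L : T -> seq nat) (p k : nat) :
  let n := p.+1 in let M := 3 * n + n * n in M * M <= k ->
  (forall x, uniq (L x) /\ size (L x) = k.+1) ->
  forall e : rel T, symmetric e -> (forall x, deg e x <= k) ->
  (forall S, S != set0 -> n * #|arcs e S| < (3 * p + 2) * #|S|) ->
  exists c, colours_on e L setT c.
Proof.
move=> n M Mk HL e; have [m] := ubnP (\sum_x deg e x).
elim: m e => // m IHm e lem se dk sparse.
have HL1 x : sqdeg e x <= k -> uniq (L x) /\ sqdeg e x < size (L x).
  by have [uL ->] := HL x; rewrite ltnS.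
have M2 : 2 < M by rewrite /M /n; lia.
have Mk2 : M * 2 <= k by apply: leq_trans Mk; rewrite leq_mul2l ltnW ?orbT.
have IH (Q : {set T}) x : x \in Q -> 0 < deg e x ->
    exists c, colours_on (del Q e) L setT c.
  move=> xQ dx; have degD y : deg (del Q e) y <= deg e y.
    by apply: subset_leq_card; apply/subsetP=> z; rewrite !inE => /and3P[].
  apply: IHm.
  - rewrite -ltnS; apply: leq_trans lem; rewrite ltnS (bigD1 x) //= [X in _ < X](bigD1 x) //=.
    rewrite -addSn leq_add ?leq_sum //.
    suff -> : deg (del Q e) x = 0 by [].
    by apply: eq_card0 => z; rewrite !inE /del xQ.
  - by move=> y z; rewrite /del se andbCA.
  - by move=> y; apply: leq_trans (degD y) (dk y).
  - move=> S S0; apply: leq_ltn_trans (sparse S S0); rewrite leq_mul2l.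
    by apply/orP; right; apply: subset_leq_card; apply/subsetP=> a;
      rewrite !inE => /and3P[-> -> /and3P[]].
have [/existsP[x /eqP d1]|/existsPn d1] := boolP [exists x, deg e x == 1].
  have [|c] := IH [set x] x (set11 x); first by rewrite d1.
  apply: reduce_free => // [z p' q /set1P -> _ _ ex xq|y /set1P ->].
    have /card_le1_eqP : deg e x <= 1 by rewrite d1.
    by apply; rewrite inE // se.
  apply: HL1; apply: leq_trans (sqdeg_leq_mul se _) _; first by move=> z _; apply: dk.
  by rewrite d1 mul1n.
have [/existsP[v /andP[vZ /existsP[x /andP[vx /eqP b0]]]]|noR2] :=
    boolP [exists v in threads e M, exists x, e v x && (bigdeg e M x == 0)].
  have dv : deg e v = 2 by move: vZ; rewrite inE => /andP[/eqP].
  have [|c] := IH [set v] v (set11 v); first by rewrite dv.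
  apply: (reduce_free (U := [set v; x])) => //.
  - by apply/subsetP=> z; rewrite !inE => ->.
  (* One of the two neighbours of [v] is [x], which lies in [U]. *)
  - move=> z a b /set1P ->; rewrite !inE !negb_or => /andP[_ ax] /andP[_ bx] av vb.
    have va : e v a by rewrite se.
    apply/eqP/negPn/negP => nab; have [xa|xb] := thread_nbrs vZ nab va vb vx.
      by rewrite xa eqxx in ax.
    by rewrite xb eqxx in bx.
  - move=> y; rewrite !inE => /orP[]/eqP ->; apply: HL1.
      apply: leq_trans (sqdeg_leq_mul (m := M) se _) _; last by rewrite dv mulnC.
      move=> z vz; apply: ltnW; have := thread_small vZ vz.
      by rewrite /big_vertex -ltnNge.
    apply: leq_trans (sqdeg_leq_mul (m := M) se _) _.
      move=> z xz; apply: ltnW; rewrite ltnNge; apply/negP => zb.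
      by have := in_set0 z; rewrite -(cards0_eq b0) inE xz /big_vertex zb.
    apply: leq_trans Mk; rewrite leq_mul2r; apply/orP; right; apply: ltnW.
    by have := thread_small vZ vx; rewrite /big_vertex -ltnNge.
have Zb : {in threads e M, forall v x, e v x -> 0 < bigdeg e M x}.
  move=> v vZ x vx; rewrite lt0n; apply: contra noR2 => b0.
  by apply/existsP; exists v; rewrite vZ; apply/existsP; exists x; rewrite vx.
have [leI|ltI] := leqP #|tight_clusters e M n| (n * #|bigs e M|); last first.
  exact: (reduce_tight_clusters se M2 Mk2 dk d1 HL IH ltI).
(* Without edges the greedy colouring suffices; otherwise the vertices of positive degree contradict
   sparsity. *)
have [S0|/sparse] := eqVneq [set x | 0 < deg e x] set0.
  have c0 : colours_on e L set0 (fun=> 0) by split=> x; rewrite inE.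
  have [x _|c cP] := colours_on_greedy se (Q := setT) _ c0.
    apply: HL1; apply: leq_trans (sqdeg_leq_mul (m := k) se _) _; first by move=> z _; apply: dk.
    suff -> : deg e x = 0 by [].
    by have := in_set0 x; rewrite -S0 inE lt0n => /negbFE/eqP.
  by exists c; rewrite set0U in cP.
rewrite ltnNge => /negP[]; apply: leq_trans (dense_of_irreducible se _ _ d1 Zb leI) _ => //.
by rewrite leq_mul2l sum_deg_leq_arcs ?orbT.
Qed.

(** * From the maximum average degree to integer bounds, and the lower bound on list sizes *)

(** Reversal matches the arcs increasing in [enum_rank] with the decreasing ones, so the halving in
    [nedges] is exact. *)
Lemma card_arcs (T : finType) (e : rel T) (S : {set T}) :
  symmetric e -> irreflexive e -> #|arcs e S| = 2 * nedges e S.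
Proof.
move=> se ie; rewrite /nedges -/(arcs e S).
pose A := [set a in arcs e S | enum_rank a.1 < enum_rank a.2].
pose sw (a : T * T) := (a.2, a.1).
have swI : injective sw by move=> [x y] [z t] [-> ->].
suff -> : #|arcs e S| = 2 * #|A| by rewrite !mul2n doubleK.
rewrite mul2n -addnn -[X in _ = X + _](card_imset _ swI) -cardsUI.
have -> : (sw @: A) :&: A = set0.
  apply/setP=> a; rewrite [RHS]inE; apply/negP => /setIP[/imsetP[b bA ->]].
  move: bA; rewrite /A !inE => /andP[_ lt1] /andP[_ /ltn_trans/(_ lt1)].
  by rewrite ltnn.
rewrite cards0 addn0; apply: eq_card => -[x y]; rewrite [RHS]inE.
apply/idP/orP => [xyS|[/imsetP[[z t]]|]].
- move: (xyS); rewrite inE /= => /and3P[xS yS xy].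
  have [lt|lt|eqr] := ltngtP (enum_rank x) (enum_rank y).
  + by right; rewrite inE xyS.
  + left; apply/imsetP; exists (y, x) => //.
    by rewrite !inE /= xS yS se xy.
  + by rewrite (enum_rank_inj (val_inj eqr)) ie in xy.
- by rewrite !inE /= => /andP[/and3P[zS tS zt] _] [-> ->]; rewrite zS tS se.
- by rewrite inE => /andP[].
Qed.

Lemma avgdeg_leq_mad (T : finType) (e : rel T) (S : {set T}) :
  S != set0 -> (avgdeg e S <= mad e)%R.
Proof.
move=> S0; rewrite /mad; have := mem_index_enum S.
elim: (index_enum _) => // A s IHs; rewrite inE big_cons.
case/orP=> [/eqP <-|/IHs le]; first by rewrite S0; apply: Rmax_l.
by case: ifP => // _; apply: Rle_trans le (Rmax_r _ _).
Qed.

(** This is the [p] of the discharging, with [n = p + 1 >= 1/eps]. *)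
Definition scale (eps : R) : nat := Z.to_nat (up (/ eps)).

Lemma scaleP (eps : R) : (0 < eps)%R -> (1 <= INR (scale eps).+1 * eps)%R.
Proof.
move=> eps0; have [+ _] := archimed (/ eps); have := Rinv_0_lt_compat _ eps0.
move=> inv0 lt; have up0 : (0 <= up (/ eps))%Z by apply: le_IZR; lra.
have : (/ eps <= INR (scale eps).+1)%R.
  by rewrite S_INR INR_IZR_INZ Znat.Z2Nat.id //; lra.
move/(Rmult_le_compat_r eps _ _ (Rlt_le _ _ eps0)).
by rewrite Rinv_l //; lra.
Qed.

(** From [n * eps >= 1] follows [n * (3 - eps) <= 3 * n - 1 = 3 * p + 2]. *)
Lemma sparse_of_mad (T : finType) (e : rel T) (eps : R) (S : {set T}) :
  symmetric e -> irreflexive e -> (0 < eps)%R -> (mad e < 3 - eps)%R -> S != set0 ->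
  (scale eps).+1 * #|arcs e S| < (3 * scale eps + 2) * #|S|.
Proof.
move=> se ie eps0 madlt S0; have := avgdeg_leq_mad e S0; rewrite /avgdeg => av.
have cS : (0 < INR #|S|)%R by apply: lt_0_INR; apply/ltP; rewrite card_gt0.
have lt1 : (2 * INR (nedges e S) < (3 - eps) * INR #|S|)%R.
  have -> : (2 * INR (nedges e S) = 2 * INR (nedges e S) / INR #|S| * INR #|S|)%R.
    by field; lra.
  by apply: Rmult_lt_compat_r => //; lra.
rewrite card_arcs //; apply/ltP/INR_lt; have := scaleP eps0.
have -> : 3 * scale eps + 2 = (scale eps).+1 + (scale eps).+1 + scale eps by lia.
set n := (scale eps).+1; have -> : scale eps = n.-1 by [].
have : (0 < INR n)%R by apply: lt_0_INR; apply/ltP.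
rewrite !mult_INR !plus_INR -[INR 2]/2%R.
have -> : INR n.-1 = (INR n - 1)%R by rewrite /n S_INR /=; lra.
move: (INR n) (INR #|S|) (INR (nedges e S)) cS lt1 => N s E s0 lt1 N0 Neps.
have : (N * (2 * E) < N * ((3 - eps) * s))%R by apply: Rmult_lt_compat_l.
have : (1 * s <= (N * eps) * s)%R by apply: Rmult_le_compat_r; lra.
nra.
Qed.

(** A vertex of maximum degree and its neighbours form a clique in the square, too large for
    identical lists of [j] colours. *)
Lemma not_sq_choosable (T : finType) (e : rel T) (j : nat) :
  symmetric e -> irreflexive e ->
  0 < maxdeg e -> j < (maxdeg e).+1 -> ~ sq_choosable e j.
Proof.
move=> se ie d0 jd ch; have T0 : 0 < #|T|.
  by rewrite lt0n; apply: contraTneq d0 => /card0_eq T0; rewrite /maxdeg big_pred0.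
have [x dx] := eq_bigmax (deg e) T0.
have [|c [cL cP]] := ch (fun=> iota 0 j).
  by move=> v; rewrite iota_uniq size_iota.
pose A := x |: [set u | e x u].
have clique : {in A &, forall y z, y != z -> sqrel e y z}.
  move=> y z yA zA nyz; rewrite /sqrel nyz /=; move: yA zA nyz; rewrite !inE.
  move=> /orP[/eqP->|xy] /orP[/eqP->|xz].
  - by rewrite eqxx.
  - by rewrite xz.
  - by rewrite se xy.
  - by move=> _; apply/orP; right; apply/existsP; exists x; rewrite se xy.
have : size [seq c y | y in A] <= size (iota 0 j).
  apply: uniq_leq_size.
    rewrite map_inj_in_uniq ?enum_uniq // => y z; rewrite !mem_enum => yA zA cyz.
    by apply: contraTeq isT => /(clique y z yA zA)/cP; rewrite cyz eqxx.
  by move=> d /mapP[y _ ->]; apply: cL.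
rewrite size_map -cardE size_iota cardsU1 inE ie add1n -/(deg e x) -dx.
by rewrite -/(maxdeg e) leqNgt jd.
Qed.

Theorem theorem1 :
  exists f : R -> R,
    forall eps : R, (0 < eps)%R ->
    forall (T : finType) (e : rel T),
      symmetric e -> irreflexive e ->
      (mad e < 3 - eps)%R ->
      (f eps <= INR (maxdeg e))%R ->
      is_chi2l e (maxdeg e).+1.
Proof.
pose M p := 3 * p.+1 + p.+1 * p.+1.
(* The threshold is the bound [M * M] of [sparse_colourable]; being positive, it also gives the
   nonzero maximum degree for the lower bound. *)
exists (fun eps => INR (M (scale eps) * M (scale eps))) => eps eps0 T e se ie madlt.
move=> /INR_le/leP leM; split=> [L HL|j]; last first.
  by apply: not_sq_choosable => //; apply: leq_trans leM; rewrite muln_gt0 /M.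
have [x||c [cL cP]] := sparse_colourable leM HL se.
- exact: leq_bigmax.
- by move=> S; apply: sparse_of_mad.
by exists c; split=> [v|x y]; [apply: cL | apply: cP]; rewrite inE.
Qed.
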